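(* Let $k\ge2$ and let $X$ be a path-connected $G$-space. Then $$\mathrm{cat}_{G^{k-1}}^{\#}(X^{k-1})\le \mathrm{TC}_{k,G}^{\#,*}(X)\le \mathrm{cat}_{G^k}^{\#}(X^k),$$ where $G^{k-1}$ and $G^k$ act componentwise on $X^{k-1}$ and $X^k$ respectively.
   Context: For a $\Gamma$-space $Y$, $\mathrm{cat}_\Gamma^{\#}(Y)$ is the smallest $n$ such that $Y$ has an open cover by $n$ $\Gamma$-invariant sets each of whose inclusions into $Y$ is null-homotopic (non-equivariantly). $X^I$ is the space of paths $[0,1]\to X$ with the compact-open topology, $e_{k,X}\colon X^I\to X^k$ is $e_{k,X}(\alpha)=\left(\alpha(0),\alpha(\tfrac1{k-1}),\dots,\alpha(\tfrac{k-2}{k-1}),\alpha(1)\right)$, and $\mathrm{TC}_{k,G}^{\#,*}(X)$ is the smallest $n$ such that $X^k$ has an open cover by $n$ sets invariant under the componentwise $G^k$-action, over each of which $e_{k,X}$ has a continuous (not necessarily equivariant) section. Each invariant is $\infty$ if no such $n$ exists. *)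

(* Defs.v *)
From HB Require Import structures.
From mathcomp Require Import all_boot all_order all_algebra.
From mathcomp Require Import all_classical all_reals topology normedtype.

Set Implicit Arguments.
Unset Strict Implicit.
Unset Printing Implicit Defensive.

Import Order.TTheory GRing.Theory Num.Theory.
Import numFieldNormedType.Exports.

Local Open Scope classical_set_scope.
Local Open Scope ring_scope.

(* No separation axiom is imposed on groups or spaces; a discrete group is a
   particular case. *)
HB.mixin Record isTopologicalGroup G & Topological G & Group G := {
  mulg_continuous : continuous (fun gh : G * G => (gh.1 * gh.2)%g);
  invg_continuous : continuous (fun g : G => (g^-1)%g)
}.

#[short(type="topGroupType")]
HB.structure Definition TopologicalGroup :=
  {G of Topological G & Group G & isTopologicalGroup G}.

HB.mixin Record isGSpace (G : topGroupType) X & Topological X := {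
  gact : G -> X -> X;
  gact1 : forall x, gact 1%g x = x;
  gactM : forall g h x, gact (g * h)%g x = gact g (gact h x);
  gact_continuous : continuous (fun gx : G * X => gact gx.1 gx.2)
}.

#[short(type="gspaceType")]
HB.structure Definition GSpace (G : topGroupType) :=
  {X of Topological X & isGSpace G X}.

Lemma ptws_continuous (I : Type) (S T : topologicalType)
    (f : S -> {ptws I -> T}) :
  (forall i, continuous (fun s => f s i)) -> continuous f.
Proof.
move=> cf s; apply/cvg_sup => i A [_ [[B oB <-] Bfs]] /filterS; apply.
by apply: (cf i s); apply: open_nbhs_nbhs; split.
Qed.

Lemma ptws_proj_continuous (I : eqType) (T : topologicalType) (i : I) :
  continuous (fun f : {ptws I -> T} => f i).
Proof. exact: (@proj_continuous I (fun=> T) i). Qed.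

Lemma ptws_continuous2 (I : eqType) (S T U : topologicalType) (i : I)
    (h : S * T -> U) :
  continuous h ->
  continuous (fun fg : {ptws I -> S} * {ptws I -> T} => h (fg.1 i, fg.2 i)).
Proof.
move=> ch fg.
apply: (@cvg_comp _ _ _
  (fun fg : {ptws I -> S} * {ptws I -> T} => (fg.1 i, fg.2 i)) h); last exact: ch.
apply: cvg_pair.
- apply: (@cvg_comp _ _ _ fst (fun f : {ptws I -> S} => f i)).
    exact: cvg_fst.
  exact: (@ptws_proj_continuous I S i fg.1).
- apply: (@cvg_comp _ _ _ snd (fun f : {ptws I -> T} => f i)).
    exact: cvg_snd.
  exact: (@ptws_proj_continuous I T i fg.2).
Qed.

Section ProductGroup.
Variables (I : eqType) (G : topGroupType).
Local Notation GI := {ptws I -> G}.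

Let one : GI := fun=> 1%g.
Let inv (g : GI) : GI := fun i => (g i)^-1%g.
Let mul (g h : GI) : GI := fun i => (g i * h i)%g.

Let mulA : associative mul.
Proof. by move=> f g h; apply/funext => i; rewrite /mul mulgA. Qed.
Let mul1 : left_id one mul.
Proof. by move=> f; apply/funext => i; rewrite /mul mul1g. Qed.
Let mulr1 : right_id one mul.
Proof. by move=> f; apply/funext => i; rewrite /mul mulg1. Qed.
Let mulV : left_inverse one inv mul.
Proof. by move=> f; apply/funext => i; rewrite /mul mulVg. Qed.
Let mulrV : right_inverse one inv mul.
Proof. by move=> f; apply/funext => i; rewrite /mul mulgV. Qed.

HB.instance Definition _ := isGroup.Build GI mulA mul1 mulr1 mulV mulrV.

Let mul_continuous : continuous (fun gh : GI * GI => (gh.1 * gh.2)%g).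
Proof.
apply: ptws_continuous => i.
exact: (@ptws_continuous2 I G G G i _ (@mulg_continuous G)).
Qed.

Let inv_continuous : continuous (fun g : GI => (g^-1)%g).
Proof.
apply: ptws_continuous => i g; apply: continuous_comp.
  exact: (@ptws_proj_continuous I G i g).
exact: (@invg_continuous G (g i)).
Qed.

HB.instance Definition _ :=
  isTopologicalGroup.Build GI mul_continuous inv_continuous.

End ProductGroup.

Section ProductGSpace.
Variables (I : eqType) (G : topGroupType) (X : gspaceType G).
Local Notation GI := {ptws I -> G}.
Local Notation XI := {ptws I -> X}.

Let act (g : GI) (x : XI) : XI := fun i => gact (g i) (x i).

Let act1 x : act 1%g x = x.
Proof. by apply/funext => i; exact: gact1. Qed.
Let actM g h x : act (g * h)%g x = act g (act h x).
Proof. by apply/funext => i; exact: gactM. Qed.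

Let act_continuous : continuous (fun gx : GI * XI => act gx.1 gx.2).
Proof.
apply: ptws_continuous => i.
exact: (@ptws_continuous2 I G X X i _ (@gact_continuous G X)).
Qed.

HB.instance Definition _ := isGSpace.Build GI XI act1 actM act_continuous.

End ProductGSpace.

Section UnitInterval.
Variable R : realType.

Definition unit_interval : Type := set_type `[0 : R, 1]%classic.

HB.instance Definition _ :=
  Topological.copy unit_interval (set_type `[0 : R, 1]%classic).

Lemma sample_time_subproof k (i : 'I_k) :
  (i%:R / (k.-1)%:R : R) \in `[0 : R, 1]%classic.
Proof.
apply/mem_set; rewrite /= in_itv /= divr_ge0 //=.
have [->|k0] := eqVneq k.-1 0; first by rewrite invr0 mulr0.
rewrite ler_pdivrMr ?ltr0n ?lt0n // mul1r ler_nat.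
by case: k i k0 => [[]//|k] i _; rewrite -ltnS.
Qed.

(* The time i / (k - 1); for k = 1 it is 0, by 0 / 0 = 0. *)
Definition sample_time k (i : 'I_k) : unit_interval :=
  SigSub (sample_time_subproof i).

Let zero_mem : 0 \in `[0 : R, 1]%classic.
Proof. by apply/mem_set; rewrite /= in_itv /= lexx ler01. Qed.
Let one_mem : 1 \in `[0 : R, 1]%classic.
Proof. by apply/mem_set; rewrite /= in_itv /= lexx ler01. Qed.

Let I0 : unit_interval := SigSub zero_mem.
Let I1 : unit_interval := SigSub one_mem.
Let I0_neq_I1 : I0 != I1.
Proof. by apply/eqP => /(congr1 val) /= /esym/eqP; rewrite oner_eq0. Qed.

(* The library's [zero] and [one] of [unit_interval] are the endpoints. *)
HB.instance Definition _ := isBiPointed.Build unit_interval I0_neq_I1.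

End UnitInterval.

Section PathSpace.
Variables (R : realType) (X : topologicalType).

Definition path_space : Type := continuousType (unit_interval R) X.

(* Topologized as a subspace of the compact-open function space. *)
HB.instance Definition _ := Topological.copy path_space
  (initial_topology (fun a : continuousType (unit_interval R) X =>
     (a : {compact-open, unit_interval R -> X}))).

Definition path_eval k (a : path_space) : {ptws 'I_k -> X} :=
  fun i => (a : continuousType (unit_interval R) X) (sample_time R i).

(* Vacuously true of the empty space. *)
Definition path_connected : Prop := forall x y : X,
  exists a : continuousType (unit_interval R) X, a zero = x /\ a one = y.

End PathSpace.
Arguments path_eval {R X} k a.

Definition homotopic (R : realType) (A Y : topologicalType) (f g : A -> Y) :=
  exists H : A * unit_interval R -> Y,
    [/\ continuous H, forall a, H (a, zero) = f a & forall a, H (a, one) = g a].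

Definition nullhomotopic (R : realType) (A Y : topologicalType) (f : A -> Y) :=
  exists y : Y, homotopic R f (cst y).

Definition invariant_set (G : topGroupType) (Y : gspaceType G) (U : set Y) :=
  forall (g : G) (y : Y), U y -> U (gact g y).

(* The case n = 0 is allowed, but only the empty space has such a cover. *)
Definition has_invariant_open_cover (G : topGroupType) (Y : gspaceType G)
    (P : set Y -> Prop) (n : nat) :=
  exists U : 'I_n -> set Y,
    [/\ forall i, open (U i), forall i, invariant_set (U i),
        \bigcup_i U i = setT & forall i, P (U i)].

Definition smallest_nat (R : realType) (P : nat -> Prop) : \bar R :=
  if pselect (exists n, `[< P n >]) is left exP then (ex_minn exP)%:R%:E
  else +oo%E.

Definition cat_sharp (R : realType) (G : topGroupType) (Y : gspaceType G) :
    \bar R :=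
  smallest_nat R (has_invariant_open_cover
    (fun U : set Y => nullhomotopic R (set_val : U -> Y))).

Definition TC_sharp_star (R : realType) (k : nat) (G : topGroupType)
    (X : gspaceType G) : \bar R :=
  smallest_nat R (has_invariant_open_cover (G := {ptws 'I_k -> G})
    (Y := {ptws 'I_k -> X})
    (fun U => exists s : U -> path_space R X,
      continuous s /\ forall u : U, path_eval k (s u) = set_val u)).

Arguments cat_sharp R G Y : clear implicits.
Arguments TC_sharp_star R k G X : clear implicits.

(* Main.v *)
Require Import Defs.
From mathcomp Require Import all_boot all_order all_algebra.
From mathcomp Require Import all_classical all_reals topology normedtype.
From mathcomp Require Import lra.

(** Write e for the evaluation of paths at the k equally spaced sample times.

    Sections of e over a set U amount to continuous families of paths through
    the k coordinates of the points of U.  For the lower bound, fix x0 in X and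
    restrict such a family to the points of U of the form (x0, x_1, ...,
    x_(k-1)): all its paths start at x0, so that pulling each path back to its
    start contracts the slice of U to the point (x0, ..., x0)
    ([nullhomotopic_of_paths]).  The slice is a G^(k-1)-invariant open subset of
    X^(k-1), because (1, g) in G^k fixes the first coordinate.  For the upper
    bound, a null-homotopy of the inclusion of U can be prolonged, X being
    path-connected, until all coordinates arrive at one point x0; the paths
    going back and forth between x0 and the coordinates in turn form a section
    over the same U ([paths_of_nullhomotopic]).

    The passage between maps A -> X^I and maps A * I -> X is the exponential law
    for the compact-open topology ([curry_path_space],
    [path_space_eval_continuous]). *)

Set Implicit Arguments.
Unset Strict Implicit.
Unset Printing Implicit Defensive.

Import Order.TTheory GRing.Theory Num.Theory.
Import numFieldNormedType.Exports.

Local Open Scope classical_set_scope.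
Local Open Scope ring_scope.

(** * Continuous maps and the unit interval *)

Lemma pair_continuous (S T U : topologicalType) (f : S -> T) (g : S -> U) :
  continuous f -> continuous g -> continuous (fun x => (f x, g x)).
Proof. by move=> cf cg x; apply: cvg_pair; [exact: cf | exact: cg]. Qed.

Lemma comp_fun_continuous (S T U : topologicalType) (f : S -> T) (g : T -> U) :
  continuous f -> continuous g -> continuous (fun x => g (f x)).
Proof. by move=> cf cg x; apply: continuous_comp; [exact: cf | exact: cg]. Qed.

Lemma fst_continuous (S T : topologicalType) : continuous (@fst S T).
Proof. by move=> p; exact: cvg_fst. Qed.

Lemma snd_continuous (S T : topologicalType) : continuous (@snd S T).
Proof. by move=> p; exact: cvg_snd. Qed.

Section Clamp.
Variable R : realType.
Implicit Types (x : R) (t : unit_interval R).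

Lemma clamp_subproof x :
  Num.max 0 (Num.min 1 x) \in `[0 : R, 1]%classic.
Proof.
by apply/mem_set; rewrite /= in_itv /= le_max lexx ge_max ler01 ge_min lexx.
Qed.

(** The retraction of the real line onto the unit interval.  Homotopies composed
    with it are defined at all real times, so that they can be reparametrized
    by arbitrary real formulas. *)
Definition clamp x : unit_interval R := SigSub (clamp_subproof x).

Lemma unit_interval_itv t : 0 <= \val t <= 1.
Proof. by have /set_mem := valP t; rewrite /= in_itv. Qed.

Lemma clamp_le0 x : x <= 0 -> clamp x = zero.
Proof.
move=> x0; apply/val_inj => /=; rewrite max_l//.
by rewrite ge_min x0 orbT.
Qed.

Lemma clamp_ge1 x : 1 <= x -> clamp x = one.
Proof. by move=> x1; apply/val_inj => /=; rewrite min_l// max_r. Qed.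

Lemma clampK t : clamp (\val t) = t.
Proof.
have /andP[t0 t1] := unit_interval_itv t.
by apply/val_inj => /=; rewrite min_r// max_r.
Qed.

Lemma val_unit_continuous : continuous (fun t => \val t : R).
Proof. exact: (@initial_continuous (unit_interval R) R set_val). Qed.

Lemma clamp_continuous : continuous clamp.
Proof.
apply: (@continuous_comp_initial (unit_interval R) R R set_val clamp) => x.
apply: (@continuous_max R R (cst 0) (fun x => Num.min 1 x)).
  exact: cst_continuous.
apply: (@continuous_min R R (cst 1) id); first exact: cst_continuous.
exact: cvg_id.
Qed.

Lemma clamp_comp_continuous (T : topologicalType) (l : T -> R) :
  continuous l -> continuous (fun a => clamp (l a)).
Proof. by move=> cl; exact: comp_fun_continuous cl clamp_continuous. Qed.

Lemma time_continuous (A : topologicalType) :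
  continuous (fun p : A * unit_interval R => \val p.2 : R).
Proof.
exact: comp_fun_continuous (@snd_continuous _ _) val_unit_continuous.
Qed.

Lemma unit_interval_compact : compact [set: unit_interval R].
Proof.
have -> : [set: unit_interval R] = clamp @` `[0, 1].
  apply/esym/seteqP; split=> // t _; exists (\val t); last exact: clampK.
  exact: unit_interval_itv.
apply: continuous_compact; last exact: segment_compact.
apply: continuous_subspaceT; exact: clamp_continuous.
Qed.

Lemma unit_interval_regular : regular_space (unit_interval R).
Proof. exact: (@uniform_regular (set_type `[0 : R, 1]%classic)). Qed.

Lemma unit_interval_locally_compact : locally_compact [set: unit_interval R].
Proof.
move=> t _; exists setT; first exact: filterT.
by split; [exact: unit_interval_compact | exact: closedT].
Qed.

End Clamp.

(** At a point where r = c, the intersection of the neighbourhoods provided by f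
    and by g works for the pasted map, since both branches take the same value
    there. *)
Lemma paste_continuous (R : realType) (T X : topologicalType) (r : T -> R)
    (c : R) (f g : T -> X) :
  continuous r -> continuous f -> continuous g ->
  (forall x, r x = c -> f x = g x) ->
  continuous (fun x => if r x <= c then f x else g x).
Proof.
move=> cr cf cg fg x W; set h := fun _ => _.
have nlt : r x < c -> nbhs x (r @^-1` [set z | z < c]).
  by move=> rxc; exact: (cr x _ (lt_nbhsl rxc)).
have ngt : c < r x -> nbhs x (r @^-1` [set z | c < z]).
  by move=> rxc; exact: (cr x _ (lt_nbhsr rxc)).
have nf : nbhs (f x) W -> nbhs x (f @^-1` W) by exact: cf.
have ng : nbhs (g x) W -> nbhs x (g @^-1` W) by exact: cg.
rewrite -[X in _ -> X]/(nbhs x (h @^-1` W)) {1}/h.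
case: (ltgtP (r x) c) => [rc|rc|rc] Wx.
- by apply: filterS (filterI (nlt rc) (nf Wx)) => y [/= /ltW ryc]; rewrite /h ryc.
- by apply: filterS (filterI (ngt rc) (ng Wx)) => y [/= ryc]; rewrite /h leNgt ryc.
- have := Wx; rewrite {1}(fg _ rc) => Wgx.
  by apply: filterS (filterI (nf Wx) (ng Wgx)) => y [? ?]; rewrite /= /h; case: ifP.
Qed.

(** * Homotopies *)

Section Homotopy.
Variable R : realType.

Lemma homotopic_trans (A Y : topologicalType) (f g h : A -> Y) :
  homotopic R f g -> homotopic R g h -> homotopic R f h.
Proof.
move=> [H [cH H0 H1]] [K [cK K0 K1]].
have creparam (L : A * unit_interval R -> Y) (l : R -> R) :
    continuous L -> continuous l ->
    continuous (fun p : A * unit_interval R => L (p.1, clamp (l (\val p.2)))).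
  move=> cL cl; apply: (comp_fun_continuous _ cL); apply: pair_continuous.
    exact: fst_continuous.
  apply: clamp_comp_continuous.
  exact: comp_fun_continuous (@time_continuous R A) cl.
exists (fun p => if \val p.2 <= 2^-1 then H (p.1, clamp (2 * \val p.2))
                 else K (p.1, clamp (2 * \val p.2 - 1))); split.
- apply: paste_continuous => //.
  + exact: time_continuous.
  + apply: (creparam H (fun x => 2 * x)) => // x.
    exact: mulrl_continuous.
  + apply: (creparam K (fun x => 2 * x - 1)) => // x.
    apply: cvgB; [exact: mulrl_continuous | exact: cvg_cst].
  + move=> [a t] /= ->; rewrite clamp_ge1 ?clamp_le0 ?H1 ?K0//; lra.
- move=> a; rewrite /= invr_ge0 ler0n clamp_le0//; lra.
- move=> a; rewrite /= ifF; last by apply/negbTE; rewrite -ltNge; lra.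
  rewrite clamp_ge1//; lra.
Qed.

Lemma homotopic_comp (A Y Z : topologicalType) (h : Y -> Z) (f g : A -> Y) :
  continuous h -> homotopic R f g ->
  homotopic R (fun a => h (f a)) (fun a => h (g a)).
Proof.
move=> ch [H [cH H0 H1]]; exists (fun p => h (H p)); split.
- exact: comp_fun_continuous cH ch.
- by move=> a; rewrite H0.
- by move=> a; rewrite H1.
Qed.

Lemma homotopic_cst (A X : topologicalType) (x y : X) :
  path_connected R X -> homotopic R (cst x : A -> X) (cst y).
Proof.
move=> /(_ x y)[p [p0 p1]]; exists (fun a => p a.2); split=> //.
apply: comp_fun_continuous; [exact: snd_continuous | exact: cts_fun].
Qed.

End Homotopy.

(** * Families of paths *)

Section Paths.
Variable R : realType.

Definition path_at (X : topologicalType) (p : path_space R X) :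
    unit_interval R -> X :=
  (p : continuousType (unit_interval R) X).

Lemma curry_path_space (A X : topologicalType)
    (F : A * unit_interval R -> X) :
  continuous F ->
  exists s : A -> path_space R X, continuous s /\
    forall a t, path_at (s a) t = F (a, t).
Proof.
move=> cF; have [cF1 cF2] := continuous_curry cF.
pose s a : path_space R X :=
  (mkcts (cF2 a) : continuousType (unit_interval R) X).
exists s; split=> //.
exact: (@continuous_comp_initial (continuousType (unit_interval R) X) A
  {compact-open, unit_interval R -> X} (fun a => a) s cF1).
Qed.

(** Evaluation is continuous for the compact-open topology because the unit
    interval is locally compact and regular. *)
Lemma path_space_eval_continuous (X : topologicalType) :
  continuous (fun p : path_space R X * unit_interval R =>
    path_at p.1 p.2).
Proof.
rewrite -[X in continuous X](funext (f := uncurry (@path_at X))); last by case.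
apply: continuous_uncurry_regular.
- exact: unit_interval_locally_compact.
- exact: unit_interval_regular.
- exact: initial_continuous.
- by move=> p; exact: cts_fun.
Qed.

(** Running every path s a backwards to its starting point contracts f: the
    coordinate i travels from s a (c i) to s a 0, and the latter is the same
    point for all a. *)
Lemma nullhomotopic_of_paths (A X : topologicalType) (n : nat)
    (s : A -> path_space R X) (c : 'I_n -> unit_interval R) (x0 : X)
    (f : A -> {ptws 'I_n -> X}) :
  continuous s ->
  (forall a, path_at (s a) zero = x0) ->
  (forall a i, path_at (s a) (c i) = f a i) ->
  nullhomotopic R f.
Proof.
move=> cs s0 sc; exists (fun=> x0).
exists (fun p i => path_at (s p.1)
  (clamp ((1 - \val p.2) * \val (c i)))); split.
- apply: ptws_continuous => i.
  apply: (@comp_fun_continuous _ _ _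
    (fun p : A * unit_interval R => (s p.1, clamp ((1 - \val p.2) * \val (c i))))
    _ _ (@path_space_eval_continuous X)).
  apply: pair_continuous.
    exact: comp_fun_continuous (@fst_continuous _ _) cs.
  apply: clamp_comp_continuous.
  apply: (comp_fun_continuous (@time_continuous R A)
    (g := fun x : R => (1 - x) * \val (c i))) => x.
  apply: cvgM; last exact: cvg_cst.
  by apply: cvgB; [exact: cvg_cst | exact: cvg_id].
- by move=> a; apply/funext => i; rewrite /= subr0 mul1r clampK sc.
- by move=> a; apply/funext => i; rewrite /= subrr mul0r clamp_le0.
Qed.

(** A null-homotopy of f, prolonged by paths in X, deforms every coordinate of f
    to the constant at one and the same point x0.  A path through the points
    f a 0, ..., f a m in this order makes an excursion from x0 to f a i and
    back around the sample time i/m, following the deformation of the i-th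
    coordinate backwards and then forwards; it reaches x0 again halfway to the
    next sample time, where the next excursion takes over. *)
Lemma paths_of_nullhomotopic (A X : topologicalType) (m : nat)
    (f : A -> {ptws 'I_m.+1 -> X}) :
  path_connected R X -> nullhomotopic R f ->
  exists s : A -> path_space R X,
    continuous s /\ forall a, path_eval m.+1 (s a) = f a.
Proof.
move=> pcX [y fy]; pose x0 := y ord0.
have /choice[K KP] (i : 'I_m.+1) :
    exists K : A * unit_interval R -> X,
      [/\ continuous K, forall a, K (a, zero) = f a i
        & forall a, K (a, one) = x0].
  have := homotopic_comp (@ptws_proj_continuous _ X i) fy.
  by move/homotopic_trans/(_ (homotopic_cst _ _ x0 pcX)).
(* Time is rescaled so that the sample times become the integers 0, ..., m. *)
pose tau (p : A * unit_interval R) : R := \val p.2 * m%:R.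
have ctau : continuous tau.
  apply: (comp_fun_continuous (@time_continuous R A) (g := fun x : R => x * m%:R)) => x.
  exact: mulrr_continuous.
pose piece j p := K (inord j) (p.1, clamp (2 * `|tau p - j%:R|)).
have cpiece j : continuous (piece j).
  have [cK _ _] := KP (inord j).
  apply: (comp_fun_continuous _ cK); apply: pair_continuous.
    exact: fst_continuous.
  apply: clamp_comp_continuous.
  apply: (comp_fun_continuous ctau (g := fun x : R => 2 * `|x - j%:R|)) => x.
  apply: cvgM; first exact: cvg_cst.
  apply: cvg_norm; apply: cvgB; [exact: cvg_id | exact: cvg_cst].
(* The excursions j and j + 1 agree at time j + 1/2, where both are at x0. *)
pose F := fix F j p := if j is i.+1 then
  if tau p <= i%:R + 2^-1 then F i p else piece j p else piece 0%N p.
have Fpiece j p : j%:R <= tau p -> F j p = piece j p.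
  case: j => //= j jp; rewrite ifF//; apply/negbTE; rewrite -ltNge.
  by move: jp; rewrite -(natr1 j); lra.
have cF j : continuous (F j).
  elim: j => [|j IHj] /=; first exact: cpiece.
  apply: paste_continuous => // p tp.
  rewrite Fpiece; last by rewrite tp; lra.
  have [[_ _ K1] [_ _ K1']] := (KP (inord j), KP (inord j.+1)).
  rewrite /piece tp -(natr1 j) !clamp_ge1 ?K1 ?K1'//.
    by rewrite ler0_norm; lra.
  by rewrite ger0_norm; lra.
have Fknot j i p : (i <= j)%N -> tau p = i%:R -> F j p = piece i p.
  elim: j => [|j IHj]; first by rewrite leqn0 => /eqP->.
  rewrite leq_eqVlt => /predU1P[-> tp|]; first by rewrite Fpiece ?tp.
  rewrite ltnS => ij tp /=; rewrite tp ifT ?IHj//.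
  by have : i%:R <= j%:R :> R by [rewrite ler_nat]; lra.
have [s [cs sF]] := curry_path_space (cF m).
exists s; split=> // a; apply/funext => i; rewrite [LHS]sF.
(* For m = 0 the sample time 0 / 0 is 0, which is still the integer i. *)
have taui : tau (a, sample_time R i) = i%:R.
  rewrite /tau /=; have [m0|m0] := eqVneq m 0%N; last first.
    by rewrite divfK// pnatr_eq0.
  have /leq_trans/(_ (eq_leq m0)) : (i <= m)%N by rewrite -ltnS.
  by rewrite leqn0 => /eqP->; rewrite !mul0r.
have im : (i <= m)%N by rewrite -ltnS.
rewrite (Fknot m i _ im taui) /piece taui subrr normr0 mulr0 clamp_le0//.
by have [_ -> _] := KP (inord i); rewrite inord_val.
Qed.

End Paths.

(** * Invariant open covers *)

Lemma has_invariant_open_cover_preimage (G G' : topGroupType)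
    (Y : gspaceType G) (Y' : gspaceType G') (phi : G' -> G) (j : Y' -> Y)
    (P : set Y -> Prop) (P' : set Y' -> Prop) (n : nat) :
  continuous j -> (forall g y, j (gact g y) = gact (phi g) (j y)) ->
  (forall U, P U -> P' (j @^-1` U)) ->
  has_invariant_open_cover P n -> has_invariant_open_cover P' n.
Proof.
move=> cj jE PP' [U [oU iU cU PU]]; exists (fun i => j @^-1` U i); split.
- by move=> i; apply: open_comp => // y _; exact: cj.
- by move=> i g y; rewrite /preimage /= jE; exact: iU.
- by rewrite -preimage_bigcup cU preimage_setT.
- by move=> i; exact: PP'.
Qed.

(** The witness m may be smaller than n because of the empty space: the cover by
    no sets is its only cover with null-homotopic inclusions, as a
    null-homotopy requires a point of the target. *)
Lemma smallest_nat_le (R : realType) (P Q : nat -> Prop) :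
  (forall n, P n -> exists2 m, (m <= n)%N & Q m) ->
  (smallest_nat R Q <= smallest_nat R P)%E.
Proof.
move=> PQ; rewrite /smallest_nat.
case: pselect => [exQ|nQ]; case: pselect => [exP|nP]; rewrite ?leey//.
- case: ex_minnP => q _ qmin; case: ex_minnP => n /asboolP/PQ[m mn Qm] _.
  by rewrite lee_fin ler_nat (leq_trans _ mn)//; apply/qmin/asboolP.
- by case: nQ; case: exP => n /asboolP/PQ[m _ Qm]; exists m; apply/asboolP.
Qed.

Definition ptws_cons (T : Type) (n : nat) (t : T) (x : {ptws 'I_n -> T}) :
    {ptws 'I_n.+1 -> T} :=
  fun i => oapp x t (unlift ord0 i).

Lemma ptws_cons0 (T : Type) n (t : T) (x : {ptws 'I_n -> T}) :
  ptws_cons t x ord0 = t.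
Proof. by rewrite /ptws_cons unlift_none. Qed.

Lemma ptws_cons_lift (T : Type) n (t : T) (x : {ptws 'I_n -> T}) i :
  ptws_cons t x (lift ord0 i) = x i.
Proof. by rewrite /ptws_cons liftK. Qed.

Lemma ptws_cons_continuous (T : topologicalType) n (t : T) :
  continuous (@ptws_cons T n t).
Proof.
apply: ptws_continuous => i; rewrite /ptws_cons.
case: (unlift ord0 i) => [j|] /=; last exact: cst_continuous.
exact: ptws_proj_continuous.
Qed.

(** * The two inequalities *)

(** An open set with a section of the path fibration pulls back along
    x |-> (x0, x) to a set on which the section yields paths all starting at
    x0, hence to a set contractible in the ambient space.  The pullback is
    invariant because this inclusion is equivariant along g |-> (1, g). *)
Lemma cat_sharp_le_TC_sharp_star (R : realType) (m : nat) (G : topGroupType)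
    (X : gspaceType G) :
  (cat_sharp R {ptws 'I_m.+1 -> G} {ptws 'I_m.+1 -> X}
     <= TC_sharp_star R m.+2 G X)%E.
Proof.
apply: smallest_nat_le => n.
(* Over an empty X the power is empty, and the cover by no sets will do. *)
have [[x0]|X0] := pselect (inhabited X); last first.
  move=> _; exists 0%N => //; exists (fun=> set0); split; try by case.
  by apply/seteqP; split=> // x _; case: X0; exists; exact: (x ord0).
move=> cover; exists n => //; move: cover.
apply: (@has_invariant_open_cover_preimage {ptws 'I_m.+2 -> G}
  {ptws 'I_m.+1 -> G} {ptws 'I_m.+2 -> X} {ptws 'I_m.+1 -> X}
  (ptws_cons 1%g) (ptws_cons x0)).
- exact: ptws_cons_continuous.
- move=> g x; apply/funext => i; rewrite /ptws_cons /gact /=.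
  by case: (unlift ord0 i) => //=; rewrite gact1.
move=> U [s [cs sU]].
pose r (v : @ptws_cons X m.+1 x0 @^-1` U) : U :=
  SigSub (valP v : ptws_cons x0 (\val v) \in U).
have cr : continuous r.
  apply: (@continuous_comp_initial U _ {ptws 'I_m.+2 -> X} set_val r).
  apply: (comp_fun_continuous _ (@ptws_cons_continuous X m.+1 x0)).
  exact: initial_continuous.
apply: (nullhomotopic_of_paths (s := s \o r) (x0 := x0)
  (c := fun i => sample_time R (lift ord0 i))).
- exact: comp_fun_continuous cr cs.
- move=> v; have := congr1 (@^~ ord0) (sU (r v)).
  rewrite /path_eval set_valE /= ptws_cons0 => <-.
  by congr (_ _); apply: val_inj; rewrite /= mul0r.
- move=> v i; have := congr1 (@^~ (lift ord0 i)) (sU (r v)).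
  rewrite /path_at /path_eval set_valE /= => ->; exact: ptws_cons_lift.
Qed.

Lemma TC_sharp_star_le_cat_sharp (R : realType) (m : nat) (G : topGroupType)
    (X : gspaceType G) (pcX : path_connected R X) :
  (TC_sharp_star R m.+1 G X
     <= cat_sharp R {ptws 'I_m.+1 -> G} {ptws 'I_m.+1 -> X})%E.
Proof.
apply: smallest_nat_le => n [U [oU iU cU nU]]; exists n => //.
exists U; split=> // i.
exact: paths_of_nullhomotopic.
Qed.

Theorem proposition3p32 (R : realType) (k : nat) (G : topGroupType)
    (X : gspaceType G) (k_ge2 : (2 <= k)%N) (pcX : path_connected R X) :
  (cat_sharp R {ptws 'I_(k - 1) -> G} {ptws 'I_(k - 1) -> X}
     <= TC_sharp_star R k G X)%E /\
  (TC_sharp_star R k G X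
     <= cat_sharp R {ptws 'I_k -> G} {ptws 'I_k -> X})%E.
Proof.
case: k k_ge2 => [|[|m]]// _; split; last exact: TC_sharp_star_le_cat_sharp.
by rewrite subn1; exact: cat_sharp_le_TC_sharp_star.
Qed.
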